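(* Let $D$ be a nonempty finite multiset of vectors $\mathbf x\in\mathbb R^n$, and suppose each $\mathbf x\in D$ satisfies $\mathbf x=\mathbf U\overline{\mathbf x}$, where $\overline{\mathbf x}\in\mathbb R^q$ is the subvector of $\mathbf x$ obtained by removing the components of functionally determined variables and $\mathbf U$ is a fixed $n\times q$ matrix of rank $q$. Let $$\boldsymbol\mu=\frac1{|D|}\sum_{\mathbf x\in D}\mathbf x,\quad \boldsymbol\Sigma_1=\frac1{|D|}\sum_{\mathbf x\in D}\mathbf x\mathbf x^\top-\boldsymbol\mu\boldsymbol\mu^\top,\quad \overline{\boldsymbol\mu}=\frac1{|D|}\sum_{\mathbf x\in D}\overline{\mathbf x},\quad \overline{\boldsymbol\Sigma}_1=\frac1{|D|}\sum_{\mathbf x\in D}\overline{\mathbf x}\,\overline{\mathbf x}^\top-\overline{\boldsymbol\mu}\,\overline{\boldsymbol\mu}^\top .$$ For some $K\le q$, let $\lambda_1,\dots,\lambda_K>0$ be the top-$K$ (positive-valued) eigenvalues of the $q\times q$ matrix $\mathbf U^\top\mathbf U\overline{\boldsymbol\Sigma}_1$ and let $\boldsymbol\eta_1,\dots,\boldsymbol\eta_K\in\mathbb R^q$ be corresponding eigenvectors. Then $\lambda_1,\dots,\lambda_K$ are also the top-$K$ eigenvalues of $\boldsymbol\Sigma_1$. Moreover, corresponding eigenvectors of $\boldsymbol\Sigma_1$ are $$\boldsymbol\theta_j=\frac1{\lambda_j}\mathbf U\overline{\boldsymbol\Sigma}_1\boldsymbol\eta_j,\qquad j\in[K].$$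
   Context: Top-$K$ eigenvalues means the $K$ largest eigenvalues counted with multiplicity. The matrix $\mathbf U$ encodes functional dependencies: $\mathbf x$ is a block vector (one block per variable), $\overline{\mathbf x}$ keeps the blocks of variables that are not functionally determined, and the $(k,l)$ block of $\mathbf U$ is the identity if the variables $k$ and $l$ coincide, the matrix $\mathbf R$ with $\mathbf x_k=\mathbf R\,\overline{\mathbf x}_l$ if there is a functional dependency $l\to k$, and zero otherwise. *)

(* Defs.v *)
From mathcomp Require Import all_boot all_order all_algebra.
From mathcomp Require Import finmap multiset.
From mathcomp Require Import reals.

Set Implicit Arguments.
Unset Strict Implicit.
Unset Printing Implicit Defensive.

Import Order.TTheory GRing.Theory Num.Theory.
Local Open Scope ring_scope.

Section Subvector.
Variables (n : nat) (V : finType).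

(* A vector of length n is split into blocks indexed by the variables V:
   var i is the variable whose block contains the i-th component, and det is
   the set of functionally determined variables. *)
Definition kept (var : 'I_n -> V) (det : {set V}) : {set 'I_n} :=
  [set i | var i \notin det].

(* enum_val enumerates S increasingly, so the remaining components keep
   their order. *)
Definition subvec (R : realType) (S : {set 'I_n}) (x : 'cV[R]_n) : 'cV[R]_#|S| :=
  \col_(j < #|S|) x (enum_val j) 0.

End Subvector.

Section Moments.
Variables (R : realType) (n d : nat).

(* Mean and covariance over the multiset {f x | x in D}, whose elements are
   counted with the multiplicities of D even when f is not injective. *)
Definition mean (D : {mset 'cV[R]_n}%mset) (f : 'cV[R]_n -> 'cV[R]_d)
    : 'cV[R]_d :=
  (size D)%:R^-1 *: \sum_(x <- D) f x.

Definition covariance (D : {mset 'cV[R]_n}%mset) (f : 'cV[R]_n -> 'cV[R]_d)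
    : 'M[R]_d :=
  (size D)%:R^-1 *: (\sum_(x <- D) f x *m (f x)^T)
  - mean D f *m (mean D f)^T.

End Moments.

Section Eigen.
Variables (R : realType) (d : nat).

(* lam lists, in any order, the K largest real eigenvalues of A counted with
   algebraic multiplicity: no value is listed more often than its
   multiplicity, and every value larger than some listed one is listed with
   its full multiplicity. *)
Definition top_eigenvalues (A : 'M[R]_d) (K : nat) (lam : 'I_K -> R) : Prop :=
  (forall a : R, (#|[set j | lam j == a]| <= mup a (char_poly A))%N) /\
  (forall (a : R) (i : 'I_K), lam i < a ->
     #|[set j | lam j == a]| = mup a (char_poly A)).

(* Right eigenvectors; the library's eigenspace acts on row vectors. *)
Definition is_eigenvector (A : 'M[R]_d) (a : R) (v : 'cV[R]_d) : Prop :=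
  v != 0 /\ A *m v = a *: v.

End Eigen.

(* Main.v *)
(* U maps the reduced vectors to the full ones, so Sigma1 = U Sigma1bar U^T.
   For P = U Sigma1bar and Q = U^T, Sylvester's identity
   X^q det(X - P Q) = X^n det(X - Q P) gives P Q = Sigma1 and
   Q P = U^T U Sigma1bar the same nonzero eigenvalues with the same
   multiplicities, and P maps eigenvectors of Q P to eigenvectors of P Q. *)
Require Import Defs.
From mathcomp Require Import all_boot all_order all_algebra.
From mathcomp Require Import finmap multiset.
From mathcomp Require Import reals.

Set Implicit Arguments.
Unset Strict Implicit.
Unset Printing Implicit Defensive.

Import Order.TTheory GRing.Theory Num.Theory.
Local Open Scope ring_scope.

(** Both sides are evaluations of ['X^q * \det M]: clearing the lower left block of [M] by column
    operations leaves [A *m B], by row operations [B *m A]. *)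
Lemma char_poly_mulmxC (R : comNzRingType) (n q : nat)
    (A : 'M[R]_(n, q)) (B : 'M[R]_(q, n)) :
  'X^q * char_poly (A *m B) = 'X^n * char_poly (B *m A).
Proof.
pose Ap := map_mx polyC A; pose Bp := map_mx polyC B.
pose M := block_mx 'X%:M Ap Bp 1%:M.
have detAB : \det M = char_poly (A *m B).
  have : M *m block_mx 1%:M 0 (- Bp) 1%:M
           = block_mx (char_poly_mx (A *m B)) Ap 0 1%:M.
    rewrite mulmx_block !mulmx1 !mulmx0 !mul1mx mulmxN addrN add0r.
    by rewrite /char_poly_mx map_mxM add0r.
  move/(congr1 determinant).
  by rewrite det_mulmx det_lblock det_ublock !det1 !mulr1.
(* The corner ['X%:M] replaces the identity so that [Bp] cancels without dividing by ['X]; its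
   determinant is the factor ['X^q]. *)
have : block_mx 1%:M 0 (- Bp) 'X%:M *m M
         = block_mx 'X%:M Ap 0 (char_poly_mx (B *m A)).
  rewrite mulmx_block !mulmx1 !mul0mx !mul1mx !addr0 mulNmx mul_mx_scalar.
  by rewrite mul_scalar_mx addNr /char_poly_mx map_mxM mulNmx addrC.
move/(congr1 determinant).
by rewrite det_mulmx det_lblock det_ublock det1 mul1r !det_scalar detAB.
Qed.

(** A nonzero [a] is not a root of a power of ['X], so those factors add nothing to its
    multiplicity. *)
Lemma mup_char_poly_mulmxC (F : fieldType) (n q : nat)
    (A : 'M[F]_(n, q)) (B : 'M[F]_(q, n)) (a : F) :
  a != 0 -> mup a (char_poly (A *m B)) = mup a (char_poly (B *m A)).
Proof.
move=> a0; have nrootX m : ~~ root ('X^m : {poly F}) a.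
  by rewrite rootE hornerXn expf_neq0.
have := congr1 (mup a) (char_poly_mulmxC A B).
by rewrite !mupMr.
Qed.

Lemma mean_mulmx (R : realType) (n d e : nat) (D : {mset 'cV[R]_n}%mset)
    (U : 'M[R]_(e, d)) (f : 'cV[R]_n -> 'cV[R]_d) (g : 'cV[R]_n -> 'cV[R]_e) :
  (forall x, x \in D -> g x = U *m f x) -> mean D g = U *m mean D f.
Proof.
move=> gE; rewrite /mean -scalemxAr mulmx_sumr; congr (_ *: _).
exact: eq_big_seq.
Qed.

(** Meant for [g = id] and [f] the subvector map, which are related by [U] only on [D]. *)
Lemma covariance_mulmx (R : realType) (n d e : nat) (D : {mset 'cV[R]_n}%mset)
    (U : 'M[R]_(e, d)) (f : 'cV[R]_n -> 'cV[R]_d) (g : 'cV[R]_n -> 'cV[R]_e) :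
  (forall x, x \in D -> g x = U *m f x) ->
  covariance D g = U *m covariance D f *m U^T.
Proof.
move=> gE; rewrite /covariance (mean_mulmx gE) mulmxBr mulmxBl.
rewrite trmx_mul !mulmxA; congr (_ - _).
rewrite -scalemxAr -scalemxAl mulmx_sumr mulmx_suml; congr (_ *: _).
apply: eq_big_seq => x xD.
by rewrite gE // trmx_mul !mulmxA.
Qed.

Lemma top_eigenvalues_mulmxC (R : realType) (n q K : nat)
    (A : 'M[R]_(n, q)) (B : 'M[R]_(q, n)) (lam : 'I_K -> R) :
  (forall j, 0 < lam j) ->
  top_eigenvalues (B *m A) lam -> top_eigenvalues (A *m B) lam.
Proof.
move=> lam_gt0 [le_mup eq_mup]; split=> [a | a i lt_a].
  (* The multiplicities may differ at 0, but the positive [lam] never lists 0, so the count there is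
     0. *)
  have [-> | a0] := eqVneq a 0; last by rewrite mup_char_poly_mulmxC.
  rewrite (_ : [set j | _] = set0) ?cards0 //.
  by apply/setP=> j; rewrite !inE gt_eqF.
rewrite mup_char_poly_mulmxC; first exact: (eq_mup a i).
by rewrite gt_eqF // (lt_trans (lam_gt0 i)).
Qed.

(** [A *m v] is nonzero because [B] sends it to [a *: v], which is nonzero. *)
Lemma is_eigenvector_mulmxC (R : realType) (n q : nat)
    (A : 'M[R]_(n, q)) (B : 'M[R]_(q, n)) (a : R) (v : 'cV[R]_q) :
  a != 0 -> is_eigenvector (B *m A) a v ->
  is_eigenvector (A *m B) a (a^-1 *: (A *m v)).
Proof.
move=> a0 [v0 BAv]; split.
  rewrite scaler_eq0 invr_eq0 (negPf a0) /=; apply/eqP => Av0.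
  move/eqP: BAv; rewrite -mulmxA Av0 mulmx0 eq_sym scaler_eq0.
  by rewrite (negPf a0) (negPf v0).
rewrite -scalemxAr -mulmxA (mulmxA B) BAv -scalemxAr.
by rewrite !scalerA mulrC.
Qed.

Theorem lemma5p4 (R : realType) (n : nat) (V : finType)
  (var : 'I_n -> V) (det : {set V})
  (D : {mset 'cV[R]_n}%mset) (U : 'M[R]_(n, #|kept var det|))
  (hD : D != mset0)
  (hU : \rank U = #|kept var det|)
  (hDU : forall x : 'cV[R]_n, x \in D -> x = U *m subvec (kept var det) x)
  (K : nat) (hK : (K <= #|kept var det|)%N)
  (lam : 'I_K -> R) (eta : 'I_K -> 'cV[R]_#|kept var det|) :
  let Sigma1 := covariance D id in
  let Sigma1bar := covariance D (subvec (kept var det)) in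
  let A := U^T *m U *m Sigma1bar in
  (forall j, 0 < lam j) ->
  top_eigenvalues A lam ->
  (forall j, is_eigenvector A (lam j) (eta j)) ->
  top_eigenvalues Sigma1 lam /\
  (forall j, is_eigenvector Sigma1 (lam j)
               ((lam j)^-1 *: (U *m Sigma1bar *m eta j))).
Proof.
move=> Sigma1 Sigma1bar A lam_gt0 topA eigA.
have -> : Sigma1 = U *m Sigma1bar *m U^T by exact: covariance_mulmx.
(* Reassociating shows [A] and [Sigma1] as the two products of the same factors [U *m Sigma1bar] and
   [U^T]. *)
have AE : A = U^T *m (U *m Sigma1bar) by rewrite mulmxA.
split; first by apply: top_eigenvalues_mulmxC; rewrite -?AE.
by move=> j; apply: is_eigenvector_mulmxC; rewrite ?gt_eqF -?AE.
Qed.
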